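(* Let $\{\tau_j\}_{j\in\mathbb{Z}}$ be a Wexler sequence and let $h\in PCAP(\mathbb{R},\mathbb{R})$ have discontinuities only at the points of a subset of $\{\tau_j\}_{j\in\mathbb{Z}}$. Suppose that $$\inf_{n\in\mathbb{Z}}|h(\tau_n)|>0,\qquad \inf_{n\in\mathbb{Z}}|h(\tau_n^+)|>0.$$ If the difference equation $$x(n)=\frac{h(\tau_n^+)}{h(\tau_n)}\cdot x(n-1),\quad n\in\mathbb{Z},$$ has a bounded solution $v:\mathbb{Z}\to\mathbb{R}$ with $\inf_{n\in\mathbb{Z}}|v(n)|>0$, then there exist $f\in AP(\mathbb{R},\mathbb{R})$ and $u\in AP(\mathbb{Z},\mathbb{R})$ such that $$h(t)=f(t)\cdot u(n),\quad \tau_n<t\le\tau_{n+1},\ n\in\mathbb{Z},$$ and the pair $(f,u)$ is unique up to a nonzero multiplicative constant; that is, if $\tilde f\in AP(\mathbb{R},\mathbb{R})$ and $\tilde u\in AP(\mathbb{Z},\mathbb{R})$ also satisfy $h(t)=\tilde f(t)\tilde u(n)$ for all $\tau_n<t\le\tau_{n+1}$, $n\in\mathbb{Z}$, then there is a real constant $c\neq 0$ with $\tilde u=cu$ and $\tilde f=c^{-1}f$.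
   Context: Let $\mathbb{G}=\mathbb{R}$ or $\mathbb{Z}$. A subset $S\subset\mathbb{G}$ is relatively dense if there is a positive $l\in\mathbb{G}$ such that $[a,a+l]\cap S\neq\emptyset$ for all $a\in\mathbb{G}$. A continuous function $f:\mathbb{G}\to\mathbb{R}$ is Bohr almost periodic if for every $\epsilon>0$ the set $T(f,\epsilon)=\{\tau\in\mathbb{G}: |f(t+\tau)-f(t)|<\epsilon\ \forall t\in\mathbb{G}\}$ is relatively dense; $AP(\mathbb{G},\mathbb{R})$ is the set of all such functions (every function on $\mathbb{Z}$ is regarded as continuous). A sequence $\{\tau_j\}_{j\in\mathbb{Z}}\subset\mathbb{R}$ is admissible if $\tau_j<\tau_{j+1}$ for all $j$ and $\lim_{j\to\pm\infty}\tau_j=\pm\infty$. Put $\tau_j^k=\tau_{j+k}-\tau_j$ for $j,k\in\mathbb{Z}$. The family $\{\{\tau_j^k\}_{j\in\mathbb{Z}}\}_{k\in\mathbb{Z}}$ is equi-potentially almost periodic if for each $\epsilon>0$ the set $\{p\in\mathbb{Z}: |\tau_{j+p}^k-\tau_j^k|<\epsilon \text{ for all } j,k\in\mathbb{Z}\}$ is relatively dense in $\mathbb{Z}$. A Wexler sequence is an admissible sequence with $\inf_{j\in\mathbb{Z}}\tau_j^1>0$ for which this family is equi-potentially almost periodic. $PC(\mathbb{R},\mathbb{R})$ is the set of functions $h:\mathbb{R}\to\mathbb{R}$ which have discontinuities, all of the first kind (finite one-sided limits exist), only at the points of a subset (possibly empty) of some admissible sequence $\{\tau_j\}$, and are continuous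 from the left at each $\tau_j$. The right limit at $\tau_n$ is denoted $h(\tau_n^+)$. A function $h\in PC(\mathbb{R},\mathbb{R})$ is piecewise continuous almost periodic (p.c.a.p.), written $h\in PCAP(\mathbb{R},\mathbb{R})$, if: (i) there is an admissible sequence $\{\tau_j\}_{j\in\mathbb{Z}}$ containing the possible discontinuities of $h$ such that the family $\{\{\tau_j^k\}_{j}\}_{k}$ is equi-potentially almost periodic; (ii) for each $\epsilon>0$ there is $\delta>0$ such that $|h(s)-h(t)|<\epsilon$ whenever $s,t\in(\tau_j,\tau_{j+1}]$ for some $j\in\mathbb{Z}$ and $|s-t|<\delta$; (iii) for each $\epsilon>0$ the set $T(h,\epsilon)=\{\tau\in\mathbb{R}: |h(t+\tau)-h(t)|<\epsilon$ for all $t\in\mathbb{R}$ such that $|t-\tau_j|>\epsilon$ for all $j\in\mathbb{Z}\}$ is relatively dense in $\mathbb{R}$. When $h$ is said to have discontinuities at the points of a subset of a given sequence $\{\tau_j\}$, that sequence is the one used in (i)-(iii). *)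

(* Defs.v *)
From HB Require Import structures.
From mathcomp Require Import all_boot all_order all_algebra.
From mathcomp Require Import all_classical all_reals all_analysis.
Set Implicit Arguments.
Unset Strict Implicit.
Unset Printing Implicit Defensive.
Import Order.TTheory GRing.Theory Num.Theory.
Import numFieldNormedType.Exports.
Local Open Scope classical_set_scope.
Local Open Scope ring_scope.

(* Used with G := R : realType and G := int. *)
Definition relatively_dense (G : numDomainType) (S : set G) : Prop :=
  exists2 l : G, 0 < l & forall a : G, `[a, a + l]%classic `&` S !=set0.

Definition translation_set (R : realType) (G : numDomainType) (f : G -> R)
    (eps : R) : set G :=
  [set p | forall t : G, `|f (t + p) - f t| < eps].

Definition ap_real (R : realType) (f : R -> R) : Prop :=
  continuous f /\
  forall eps : R, 0 < eps -> relatively_dense (translation_set f eps).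

(* Every function on int is regarded as continuous. *)
Definition ap_int (R : realType) (u : int -> R) : Prop :=
  forall eps : R, 0 < eps -> relatively_dense (translation_set u eps).

Definition admissible (R : realType) (tau : int -> R) : Prop :=
  [/\ forall j : int, tau j < tau (j + 1),
      tau n%:Z @[n --> \oo] --> +oo
    & tau (- n%:Z) @[n --> \oo] --> -oo].

Definition tdiff (R : realType) (tau : int -> R) (k j : int) : R :=
  tau (j + k) - tau j.

Definition equipotentially_ap (R : realType) (tau : int -> R) : Prop :=
  forall eps : R, 0 < eps ->
    relatively_dense [set p : int |
      forall j k : int, `|tdiff tau k (j + p) - tdiff tau k j| < eps].

Definition wexler (R : realType) (tau : int -> R) : Prop :=
  [/\ admissible tau, 0 < inf (range (tdiff tau 1)) & equipotentially_ap tau].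

(* The right limit h(t^+); meaningful when the limit exists. *)
Definition right_lim (R : realType) (h : R -> R) (t : R) : R :=
  lim (h x @[x --> t^'+]).

(* Membership in PC(R,R), with discontinuities only at points of the given
   sequence tau; the left limits are finite by left continuity. *)
Definition pc_on (R : realType) (tau : int -> R) (h : R -> R) : Prop :=
  [/\ admissible tau,
      forall t : R, ~ range tau t -> {for t, continuous h},
      forall j : int, h x @[x --> (tau j)^'-] --> h (tau j)
    & forall j : int, cvg (h x @[x --> (tau j)^'+])].

Definition pc_translation_set (R : realType) (tau : int -> R) (h : R -> R)
    (eps : R) : set R :=
  [set p | forall t : R, (forall j : int, eps < `|t - tau j|) ->
             `|h (t + p) - h t| < eps].

(* Membership in PCAP(R,R), with tau the sequence used in (i)-(iii). *)
Definition pcap_on (R : realType) (tau : int -> R) (h : R -> R) : Prop :=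
  [/\ pc_on tau h,
      equipotentially_ap tau,
      forall eps : R, 0 < eps -> exists2 delta : R, 0 < delta &
        forall (j : int) (s t : R),
          s \in `]tau j, tau (j + 1)] -> t \in `]tau j, tau (j + 1)] ->
          `|s - t| < delta -> `|h s - h t| < eps
    & forall eps : R, 0 < eps ->
        relatively_dense (pc_translation_set tau h eps)].

Definition pc_factorization (R : realType) (tau : int -> R) (h f : R -> R)
    (u : int -> R) : Prop :=
  forall (n : int) (t : R), tau n < t <= tau (n + 1) -> h t = f t * u n.

(* Main.v *)
Require Import Defs.
From mathcomp Require Import all_boot all_order all_algebra.
From mathcomp Require Import all_classical all_reals all_analysis.
From mathcomp Require Import zify ring lra.
Import Order.TTheory GRing.Theory Num.Theory.
Import numFieldNormedType.Exports.
Local Open Scope classical_set_scope.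
Local Open Scope ring_scope.

Set Implicit Arguments.
Unset Strict Implicit.

(** The discrete factor is u = v and the continuous factor is f = h / v, with
    v read off on the intervals of tau; the difference equation for v says
    exactly that the jumps of h and of v cancel, so that f is continuous, and
    in fact uniformly continuous (quotient_uc).

    Almost periodicity of both factors rests on joint periods: pairs (r, p)
    such that translation by r almost preserves h away from tau and carries
    tau nearly to its shift by p.  They are relatively dense
    (joint_period_dense), by a pigeonhole argument on the differences between
    translation numbers r of h and increments tau p - tau 0, where p is a
    translation number of the family of differences of tau.  A joint period
    nearly preserves the left and right limits of h along tau, hence the
    coefficients of the difference equation (joint_period_values).

    For the solution v, ln |v| is a bounded sequence whose differences are
    almost periodic.  Bohr's argument (bounded_sum_translation) shows that fine
    translation numbers of the differences are translation numbers of the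
    sequence itself.  The sign of v (n + p) v n does not depend on n, so p is an
    almost period of v up to a global sign (solution_translation); the same then
    holds for r and f with the same sign (joint_period_factors), and doubling
    the pair (r, p) removes the sign.

    Uniqueness: at tau n, both factorizations express h (tau n) and its right
    limit, which are nonzero; dividing shows that the quotient of the discrete
    factors is constant (factorization_unique). *)

(** * Bounds, increments and relatively dense sets *)

(* Replaces the bounds on absolute values among the hypotheses by pairs of
   inequalities, so that linear arithmetic can use them. *)
Ltac norm_hyps := repeat match goal with
  | H : is_true (Num.norm _ < _) |- _ =>
      move: H; rewrite ltr_norml => /andP[? ?]
  | H : is_true (Num.norm _ <= _) |- _ =>
      move: H; rewrite ler_norml => /andP[? ?]
  end.

Ltac norm_lra := norm_hyps;
  rewrite ?ltr_norml ?ler_norml; apply/andP; split; lra.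

Lemma inf_range_le (R : realType) (I : Type) (F : I -> R) :
  (forall i, 0 <= F i) -> forall i, inf (range F) <= F i.
Proof.
move=> F0 i; apply: ge_inf; last by exists i.
by exists 0 => _ [j _ <-].
Qed.

Lemma finite_bound (R : realType) (g : nat -> R) (N : nat) :
  exists2 K : R, 0 < K & forall k : nat, (k < N)%N -> `|g k| <= K.
Proof.
elim: N => [|N [K K0 hK]]; first by exists 1.
exists (K + `|g N|) => [|k]; first by rewrite ltr_pwDl.
rewrite ltnS leq_eqVlt => /orP[/eqP ->|/hK hk]; first by rewrite lerDr ltW.
by rewrite (le_trans hk)// lerDl.
Qed.

Lemma incr_ge (R : realType) (F : int -> R) (c : R) :
  (forall j : int, c <= F (j + 1) - F j) ->
  forall j k : int, j <= k -> (k - j)%:~R * c <= F k - F j.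
Proof.
move=> hF j k jk; have [n ->] : exists n : nat, k = j + n%:Z.
  by exists `|k - j|%N; lia.
rewrite (addrC j) addrK; elim: n => [|n IH].
  by rewrite add0r !subrr mul0r.
have := hF (n%:Z + j).
rewrite (_ : n.+1%:Z + j = n%:Z + j + 1); last by lia.
rewrite -addn1 PoszD intrD mulrDl mul1r; lra.
Qed.

Lemma incr_le (R : realType) (F : int -> R) (c : R) :
  (forall j : int, F (j + 1) - F j <= c) ->
  forall j k : int, j <= k -> F k - F j <= (k - j)%:~R * c.
Proof.
move=> hF j k jk.
have H i : - c <= - F (i + 1) - - F i by have := hF i; lra.
have := incr_ge (R := R) (F := fun i => - F i) H jk.
by rewrite mulrN; lra.
Qed.

Lemma incr_dist (R : realType) (F : int -> R) (c : R) :
  (forall j : int, `|F j - F (j - 1)| < c) ->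
  forall j k l : int, j <= k <= j + l -> `|F k - F j| <= l%:~R * c.
Proof.
move=> hF j k l /andP[jk kl].
have c0 : 0 < c by apply: le_lt_trans (hF 0).
have h1 : (k - j)%:~R * c <= l%:~R * c.
  by rewrite ler_pM2r// ler_int; lia.
have hF' i : `|F (i + 1) - F i| < c by have := hF (i + 1); rewrite addrK.
have h2 i : F (i + 1) - F i <= c.
    have := hF' i => ?; norm_hyps; lra.
have h3 i : - c <= F (i + 1) - F i by have := hF' i => ?; norm_hyps; lra.
have := incr_ge h3 jk; have := incr_le h2 jk; rewrite mulrN => ? ?.
by rewrite ler_norml; apply/andP; split; lra.
Qed.

Lemma int_floor (R : realType) (x : R) :
  exists2 n : int, 0 < n & x <= n%:~R.
Proof.
move: (ceil_ge x); move: (Num.ceil x) => n xn.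
exists (`|n|%N%:Z + 1); first by lia.
by apply: le_trans xn _; rewrite ler_int; lia.
Qed.

Lemma relatively_denseP (G : numDomainType) (S : set G) :
  relatively_dense S <->
  exists2 l : G, 0 < l & forall a : G, exists2 p : G, a <= p <= a + l & S p.
Proof.
split=> -[l l0 hl]; exists l => // a; have := hl a.
  by move=> [p []]; rewrite /= in_itv /= => alp Sp; exists p.
by move=> [p alp Sp]; exists p; split; rewrite //= in_itv.
Qed.

Lemma relatively_dense_intP (S : set int) :
  relatively_dense S <->
  exists2 l : int, 0 < l & forall a : int, exists2 p : int, a <= p <= a + l & S p.
Proof. exact: relatively_denseP. Qed.

(** * Almost periodic two-sided sequences *)

Lemma ap_int_bounded (R : realType) (u : int -> R) : ap_int u ->
  exists2 M : R, 0 < M & forall n : int, `|u n| <= M.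
Proof.
move=> /(_ 1 ltr01)/relatively_dense_intP[l l0 hl].
have [K K0 hK] := finite_bound (R := R) (fun k => u k%:Z) (absz (l + 1)).
exists (K + 1) => [|n]; first by lra.
have [p /andP[p1 p2] hp] := hl (- n).
have : `|u (n + p)%R| <= K.
  have -> : n + p = (absz (n + p))%:Z by lia.
  by apply: hK; lia.
move: (hp n) => ? ?; norm_lra.
Qed.

(** Bohr's theorem on bounded sums, in a form that keeps track of the
    translations: every translation number of the differences, for a fine
    enough tolerance, is one of the sequence itself.  The sequence comes within
    a small distance of its infimum on every integer interval of some fixed
    length; comparing with such points bounds the increment from both sides. *)
Lemma bounded_sum_translation (R : realType) (B : int -> R) (M : R) :
  (forall n, `|B n| <= M) -> ap_int (fun n => B n - B (n - 1)) ->
  forall eps : R, 0 < eps -> exists2 delta : R, 0 < delta &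
    forall p, translation_set (fun n => B n - B (n - 1)) delta p ->
      translation_set B eps p.
Proof.
move=> hM hap eps eps0.
pose e := eps / 5; have e0 : 0 < e by rewrite divr_gt0.
have hasup : has_sup (range B).
  split; [by exists (B 0), 0 | exists M => _ [n _ <-]].
  by have := hM n => ?; norm_hyps.
have hasinf : has_inf (range B).
  split; [by exists (B 0), 0 | exists (- M) => _ [n _ <-]].
  by have := hM n => ?; norm_hyps.
have ub n : B n <= sup (range B) by apply: ub_le_sup; [case: hasup | exists n].
have lb n : inf (range B) <= B n by apply: ge_inf; [case: hasinf | exists n].
have [_ [n1 _ <-] hn1] := inf_adherent e0 hasinf.
have [_ [n2 _ <-] hn2] := sup_adherent e0 hasup.
have shift_dist p (d : R) : translation_set (fun n => B n - B (n - 1)) d p ->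
    forall j k l : int, j <= k <= j + l ->
    `|(B (k + p) - B k) - (B (j + p) - B j)| <= l%:~R * d.
  move=> hp; apply: (incr_dist (F := fun n => B (n + p) - B n)) => n.
  have := hp n => /=; rewrite (addrAC n (-1)) => h.
  by rewrite (_ : _ - _ = B (n + p) - B (n + p - 1) - (B n - B (n - 1)));
    [exact: h | lra].
(* d exceeds the distance from n1 to n2, so for p a translation number of the
   differences, B (n2 + p) - B (n1 + p) is almost as large as the oscillation
   of B, which forces B (n1 + p) to be near the infimum. *)
pose d := `|n1 - n2| + 1.
have d0 : 0 < d%:~R :> R by rewrite ltr0z; lia.
have /relatively_dense_intP[l l0 hl] := hap (e / d%:~R) (divr_gt0 e0 d0).
have low n : exists2 k, n <= k <= n + l & B k <= inf (range B) + 3 * e.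
  have [p /andP[p1 p2] hp] := hl (n - n1).
  exists (n1 + p); first by lia.
  have : `|(B (n1 + p) - B n1) - (B (n2 + p) - B n2)| <= e.
    rewrite -[leRHS](divfK (lt0r_neq0 d0)) mulrC.
    have [n12|/ltW n12] := leP n1 n2.
      by rewrite distrC; apply: shift_dist hp _ _ _ _; lia.
    by apply: shift_dist hp _ _ _ _; lia.
  have := ub (n2 + p); move=> ? ?; norm_hyps; lra.
have l0R : 0 < l%:~R :> R by rewrite ltr0z.
exists (e / l%:~R) => [|p hp n]; first by rewrite divr_gt0.
have close j k : j <= k <= j + l ->
    `|(B (k + p) - B k) - (B (j + p) - B j)| <= e.
  by move=> jk; rewrite -[leRHS](divfK (lt0r_neq0 l0R)) mulrC; apply: shift_dist.
have [k1 hk1 lowk1] := low n.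
have [k2 hk2 lowk2] := low (n + p).
have := close _ _ hk1.
have /close : n <= k2 - p <= n + l by lia.
rewrite subrK; have := lb (k1 + p); have := lb (k2 - p).
have : eps = 5 * e by rewrite mulrC divfK.
move=> -> ? ? ? ?; norm_lra.
Qed.

(** * Separated sequences *)

Lemma separated_le (R : realType) (tau : int -> R) (theta : R) :
  0 < theta -> (forall j : int, theta <= tau (j + 1) - tau j) ->
  forall j k : int, j < k -> theta <= tau k - tau j.
Proof.
move=> theta0 sep j k jk; apply: le_trans (incr_ge sep (ltW jk)).
by rewrite ler_peMl ?(ltW theta0)// (ler_int R 1); lia.
Qed.

Lemma separated_lt_idx (R : realType) (tau : int -> R) (theta : R) :
  0 < theta -> (forall j : int, theta <= tau (j + 1) - tau j) ->
  forall j k : int, tau j < tau k -> j < k.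
Proof.
move=> theta0 sep j k jk; rewrite ltNge; apply/negP.
rewrite le_eqVlt => /orP[/eqP kj|kj]; first by rewrite kj ltxx in jk.
by have := separated_le theta0 sep kj; lra.
Qed.

Lemma interval_idx_unique (R : realType) (tau : int -> R) (theta : R) :
  0 < theta -> (forall j : int, theta <= tau (j + 1) - tau j) ->
  forall (t : R) (m n : int), tau m < t <= tau (m + 1) ->
    tau n < t <= tau (n + 1) -> m = n.
Proof.
move=> theta0 sep t m n /andP[m1 m2] /andP[n1 n2].
have lt := separated_lt_idx theta0 sep.
have := lt m (n + 1) (lt_le_trans m1 n2).
have := lt n (m + 1) (lt_le_trans n1 m2).
lia.
Qed.

Lemma admissible_interval (R : realType) (tau : int -> R) : admissible tau ->
  forall t : R, exists n : int, tau n < t <= tau (n + 1).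
Proof.
move=> [_ tauy tauNy] t.
have [N _ hN] : \forall n \near \oo, t <= tau n%:Z by apply/cvgryPge: t.
have [M _ hM] : \forall n \near \oo, tau (- n%:Z) <= t - 1 by apply/cvgrNyPle: (t - 1).
have ex : exists k : nat, t <= tau (k%:Z - M%:Z).
  by exists (N + M)%N; rewrite PoszD addrK; apply: hN => /=.
case: (ex_minnP ex) => -[|k] tk kmin.
  by move: tk; rewrite sub0r => /le_trans/(_ (hM M (leqnn M))); lra.
exists (k%:Z - M%:Z); rewrite (_ : _ + 1 = k.+1%:Z - M%:Z); last by lia.
rewrite tk andbT ltNge; apply/negP => /kmin; by rewrite ltnn.
Qed.

Lemma equipotentially_ap_gap_bounded (R : realType) (tau : int -> R) :
  equipotentially_ap tau ->
  exists2 D : R, 0 < D & forall j : int, tau (j + 1) - tau j <= D.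
Proof.
move=> hap; have [|D D0 hD] := ap_int_bounded (u := tdiff tau 1).
  move=> eps /hap/relatively_dense_intP[l l0 hl].
  apply/relatively_dense_intP; exists l => // a.
  by have [p ap hp] := hl a; exists p => // j; apply: hp.
by exists D => // j; apply: le_trans (hD j); exact: ler_norm.
Qed.

(** Every point can be moved slightly to the right, away from a separated
    sequence. *)
Lemma shift_away (R : realType) (tau : int -> R) (theta e : R) :
  (forall j k : int, j < k -> theta <= tau k - tau j) ->
  0 < e -> 5 * e < theta ->
  forall x : R, exists2 y : R, x <= y <= x + 3 * e &
    forall j : int, e < `|y - tau j|.
Proof.
move=> sep e0 he x.
have [[j xj]|far] := pselect (exists j : int, `|x - tau j| <= e); last first.
  exists x => [|j]; first by apply/andP; split; lra.
  by rewrite ltNge; apply/negP => xj; apply: far; exists j.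
exists (x + 3 * e) => [|k]; first by apply/andP; split; lra.
rewrite lter_normr; norm_hyps.
have [jk|kj|<-] := ltgtP j k; last by apply/orP; left; lra.
  by have := sep _ _ jk => ?; apply/orP; right; lra.
by have := sep _ _ kj => ?; apply/orP; left; lra.
Qed.

(** A pigeonhole principle: if there are relatively dense r paired with x such
    that r - phi x stays bounded, then the differences r - s over two such pairs
    (r, x) and (s, y) remain relatively dense when r - s is moreover required
    to be close to phi x - phi y. *)
Lemma close_differences_dense (R : realType) (X : Type) (A : R -> X -> Prop)
    (phi : X -> R) (L : R) :
  (forall a : R, exists r x, [/\ a <= r <= a + L, A r x & `|r - phi x| <= L]) ->
  forall e : R, 0 < e -> exists2 K : R, 0 < K & forall a : R,
    exists r x s y, [/\ a <= r - s <= a + K, A r x, A s y &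
      `|(r - phi x) - (s - phi y)| < e].
Proof.
move=> hA e e0.
pose cell (c : nat) (z : R * X) := [/\ A z.1 z.2 &
  c%:R <= (z.1 - phi z.2 + L) / e < c.+1%:R].
(* In each cell that contains a point, one such point is chosen. *)
have [g hg] : {g : nat -> R * X & forall c, (exists z, cell c z) -> cell c (g c)}.
  apply: (@choice _ _ (fun c y => (exists z, cell c z) -> cell c y)) => c.
  have [[z hz]|no] := pselect (exists z, cell c z); first by exists z.
  by have [r [x _]] := hA 0; exists (r, x) => /no.
have L0 : 0 <= L by have [r [x [/andP[? ?] _ _]]] := hA 0; lra.
have [K K0 hK] := finite_bound (fun c => (g c).1) (Num.truncn ((L + L) / e)).+1.
exists (2 * K + L) => [|a]; first lra.
have [r [x [rL Arx rx]]] := hA (a + K).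
have pos : 0 <= (r - phi x + L) / e by apply: divr_ge0; norm_hyps; lra.
pose c := Num.truncn ((r - phi x + L) / e).
have cell_rx : cell c (r, x) by split => //; exact: truncn_itv.
have [Ag /andP[g1 g2]] := hg c (ex_intro _ _ cell_rx).
have [_ /andP[/= c1 c2]] := cell_rx.
have : `|(g c).1| <= K.
  apply: hK; rewrite ltnS; apply: le_truncn.
  by rewrite ler_pM2r ?invr_gt0//; norm_hyps; lra.
exists r, x, (g c).1, (g c).2; split => //.
  by case/andP: rL => ? ?; norm_hyps; apply/andP; split; lra.
move: g1 g2 c1 c2; rewrite !ler_pdivlMr// !ltr_pdivrMr// -natr1.
rewrite !mulrDl !mul1r => *; norm_lra.
Qed.

(** * Joint periods of a sequence and a function *)

(** Uniform continuity of h on the half-open intervals of tau, with a modulus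
    common to all of them. *)
Definition piecewise_uc (R : realType) (tau : int -> R) (h : R -> R) : Prop :=
  forall eps : R, 0 < eps -> exists2 delta : R, 0 < delta &
    forall (j : int) (s t : R), tau j < s <= tau (j + 1) ->
      tau j < t <= tau (j + 1) -> `|s - t| < delta -> `|h s - h t| < eps.

(** A pair of a real r and an integer p, where translation by r almost
    preserves h away from tau and almost carries tau to tau shifted by p. *)
Definition joint_period (R : realType) (tau : int -> R) (h : R -> R) (eps r : R)
    (p : int) : Prop :=
  (forall j : int, `|tau (j + p) - tau j - r| < eps) /\
  pc_translation_set tau h eps r.

Lemma joint_period_le (R : realType) (tau : int -> R) (h : R -> R)
    (e e' r : R) (p : int) :
  e <= e' -> joint_period tau h e r p -> joint_period tau h e' r p.
Proof.
move=> ee' [h1 h2]; split=> [j|t far]; first exact: lt_le_trans (h1 j) ee'.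
by apply: (lt_le_trans _ ee'); apply: h2 => j; apply: le_lt_trans (far j).
Qed.

Lemma small_pos (R : realType) (a b c : R) : 0 < a -> 0 < b -> 0 < c ->
  exists2 e : R, 0 < e & [/\ e <= a, e <= b & e <= c].
Proof.
move=> a0 b0 c0; exists (Num.min a (Num.min b c)).
  by rewrite !lt_min a0 b0 c0.
by split; rewrite !ge_min ?lexx ?orbT.
Qed.

Lemma joint_period_dense (R : realType) (tau : int -> R) (h : R -> R)
    (theta : R) :
  0 < theta -> (forall j : int, theta <= tau (j + 1) - tau j) ->
  admissible tau -> equipotentially_ap tau -> piecewise_uc tau h ->
  (forall eps : R, 0 < eps -> relatively_dense (pc_translation_set tau h eps)) ->
  forall eps : R, 0 < eps -> exists2 L : R, 0 < L &
    forall a : R, exists r p, a <= r <= a + L /\ joint_period tau h eps r p.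
Proof.
move=> theta0 sep adm eap uc hap eps eps0.
have [D D0 hD] := equipotentially_ap_gap_bounded eap.
have [d d0 hd] := uc (eps / 4) (divr_gt0 eps0 (ltr0n _ 4)).
have [e e0 [e1 e2 e3]] : exists2 e : R, 0 < e & [/\ e <= eps / 8, e <= theta / 6 &
  e <= d / 4] by apply: small_pos; apply: divr_gt0.
have /relatively_denseP[l1 l10 hl1] := hap e e0.
have /relatively_dense_intP[l2 l20 hl2] := eap e e0.
pose phi p := tau p - tau 0.
pose A r p := pc_translation_set tau h e r /\
  forall j : int, `|tau (j + p) - tau j - phi p| < e.
have hA a : exists r p, [/\ a <= r <= a + (l1 + (D + l2%:~R * D)), A r p &
    `|r - phi p| <= l1 + (D + l2%:~R * D)].
  have [r /andP[r1 r2] hr] := hl1 a.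
  have [n /andP[n1 n2]] := admissible_interval adm (a + tau 0).
  have [p /andP[p1 p2] hp] := hl2 (n + 1).
  have l2D : 0 < l2%:~R * D by rewrite mulr_gt0 ?ltr0z.
  have q1 : tau (n + 1) <= tau p.
    rewrite -subr_ge0; apply: le_trans (incr_ge sep p1).
    by rewrite mulr_ge0 ?(ltW theta0)// ler0z subr_ge0.
  have q2 : tau p - tau (n + 1) <= l2%:~R * D.
    apply: le_trans (incr_le hD p1) _.
    by rewrite ler_pM2r// ler_int lerBlDl.
  have q3 := hD n.
  exists r, p; split; rewrite /phi; [by apply/andP; split; lra | | by norm_lra].
  split=> // j; have := hp 0 j.
  by rewrite /tdiff /phi !add0r (addrC p) => ?; norm_lra.
have [K K0 hK] := close_differences_dense hA e0.
exists K => // a; have [r [p [s [q [ra [hr hp] [hs hq] rs]]]]] := hK a.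
exists (r - s), (p - q).
have near j : `|tau (j + (p - q)) - tau j - (r - s)| < 3 * e.
  have := hp (j - q); have := hq (j - q).
  by rewrite subrK addrCA addrC -addrA => ? ?; norm_lra.
do 2!split => //; first by move=> j; apply: lt_le_trans (near j) _; lra.
move=> t far.
have sep' := separated_le theta0 sep.
(* The translates of tau by s need not lie near tau, so t - s may be close to
   some tau j; uniform continuity allows moving it to a good point y. *)
have [y /andP[y1 y2] fary] : exists2 y, t - s <= y <= t - s + 3 * e &
    forall j, e < `|y - tau j| by apply: (shift_away sep'); lra.
have [n /andP[n1 n2]] := admissible_interval adm t.
have m1 : eps < t - tau n by have := far n; rewrite gtr0_norm ?subr_gt0.
have m2 : eps < tau (n + 1) - t.
  by have := far (n + 1); rewrite distrC ger0_norm ?subr_ge0.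
have b1 : `|h t - h (y + s)| < eps / 4.
  by apply: (hd n); [apply/andP; split; lra | apply/andP; split; lra | norm_lra].
have b2 : `|h (t + (r - s)) - h (y + r)| < eps / 4.
  have := near n; have := near (n + 1); rewrite (addrAC n 1) => *.
  apply: (hd (n + (p - q))); last by norm_lra.
    by norm_hyps; apply/andP; split; lra.
  by norm_hyps; apply/andP; split; lra.
have b3 := hr y fary; have b4 := hs y fary.
by norm_lra.
Qed.

Lemma right_lim_close (R : realType) (tau : int -> R) (h : R -> R) (eps d : R) :
  (forall j : int, tau j < tau (j + 1)) ->
  (forall j : int, cvg (h x @[x --> (tau j)^'+])) ->
  (forall (j : int) (s t : R), tau j < s <= tau (j + 1) ->
    tau j < t <= tau (j + 1) -> `|s - t| < d -> `|h s - h t| < eps) ->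
  forall (j : int) (t : R), tau j < t <= tau (j + 1) -> t - tau j < d ->
    `|h t - right_lim h (tau j)| <= eps.
Proof.
move=> inc hcv hd j t /andP[t1 t2] td; apply/ler_addgt0Pr => eta eta0.
have /cvgr_dist_le/(_ eta eta0) hn := hcv j.
have [x [xt [tx /= hx]]] : exists x, x < t /\ tau j < x /\
    `|right_lim h (tau j) - h x| <= eta.
  apply: (@filter_ex _ (tau j)^'+).
  apply: filterI; first exact: nbhs_right_lt.
  by apply: filterI => //; exact: nbhs_right_gt.
have : `|h t - h x| < eps.
  apply: (hd j); [by rewrite t1 | by rewrite tx (le_trans (ltW xt)) | ].
  by norm_lra.
by move=> ?; norm_lra.
Qed.

(** A fine enough joint period is an almost period of the left and right
    limits of h along tau. *)
Lemma joint_period_values (R : realType) (tau : int -> R) (h : R -> R)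
    (theta : R) :
  0 < theta -> (forall j : int, theta <= tau (j + 1) - tau j) ->
  piecewise_uc tau h -> (forall j : int, cvg (h x @[x --> (tau j)^'+])) ->
  forall eps : R, 0 < eps -> exists2 e : R, 0 < e &
    forall r p, joint_period tau h e r p -> forall n : int,
      `|h (tau (n + p)) - h (tau n)| < eps /\
      `|right_lim h (tau (n + p)) - right_lim h (tau n)| < eps.
Proof.
move=> theta0 sep uc hcv eps eps0.
have [d d0 hd] := uc (eps / 4) (divr_gt0 eps0 (ltr0n _ 4)).
have [e e0 [e1 e2 e3]] : exists2 e : R, 0 < e & [/\ e <= eps / 8, e <= theta / 8 &
  e <= d / 4] by apply: small_pos; apply: divr_gt0.
have inc j : tau j < tau (j + 1) by have := sep j; lra.
have rl := right_lim_close inc hcv hd.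
have sep' := separated_le theta0 sep.
have far t n : 2 * e = `|t - tau n| -> forall j, e < `|t - tau j|.
  move=> tn j; have tn' : `|t - tau n| <= 2 * e by rewrite tn.
  have [jn|nj|->] := ltgtP j n; last by rewrite -tn; lra.
    by have := sep' _ _ jn => ?; norm_hyps; rewrite lter_normr; apply/orP; left; lra.
  by have := sep' _ _ nj => ?; norm_hyps; rewrite lter_normr; apply/orP; right; lra.
exists e => // r p [near hr] n.
have near0 := near n; have sepn := sep n; have sepnp := sep (n + p).
split.
  have := sep (n - 1); have := sep (n + p - 1); rewrite !subrK => s1 s2.
  have b1 : `|h (tau n - 2 * e + r) - h (tau n - 2 * e)| < e.
    by apply: hr; apply: (far _ n); rewrite addrAC subrr add0r normrN gtr0_norm//; lra.
  have b2 : `|h (tau n) - h (tau n - 2 * e)| < eps / 4.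
    by apply: (hd (n - 1)); rewrite ?subrK;
      [apply/andP; split; lra | apply/andP; split; lra | norm_lra].
  have b3 : `|h (tau (n + p)) - h (tau n - 2 * e + r)| < eps / 4.
    by norm_hyps; apply: (hd (n + p - 1)); rewrite ?subrK;
      [apply/andP; split; lra | apply/andP; split; lra | norm_lra].
  by norm_lra.
have b1 : `|h (tau n + 2 * e + r) - h (tau n + 2 * e)| < e.
  by apply: hr; apply: (far _ n); rewrite addrAC subrr add0r gtr0_norm//; lra.
have b2 : `|h (tau n + 2 * e) - right_lim h (tau n)| <= eps / 4.
  by apply: rl; [apply/andP; split; lra | lra].
have b3 : `|h (tau n + 2 * e + r) - right_lim h (tau (n + p))| <= eps / 4.
  by norm_hyps; apply: rl; [apply/andP; split; lra | lra].
by norm_lra.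
Qed.

(** * Bounded solutions of first order linear difference equations *)

Lemma ln_dist_le (R : realType) (c x y : R) :
  0 < c -> c <= x -> c <= y -> `|ln x - ln y| <= `|x - y| / c.
Proof.
move=> c0.
have H (a b : R) : c <= a -> c <= b -> ln a - ln b <= `|a - b| / c.
  move=> ca cb; have a0 : 0 < a := lt_le_trans c0 ca.
  have b0 : 0 < b := lt_le_trans c0 cb.
  rewrite -ln_div ?posrE// (_ : a / b = 1 + (a - b) / b); last first.
    by rewrite mulrBl divff ?lt0r_neq0// addrC subrK.
  apply: le_trans (le_ln1Dx _) _.
    by rewrite mulrBl divff ?lt0r_neq0// ltrBDr addrC subrr divr_gt0.
  apply: le_trans (_ : `|a - b| / b <= _).
    by rewrite ler_pM2r ?invr_gt0// ler_norm.
  by rewrite ler_wpM2l// lef_pV2.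
move=> cx cy; rewrite ler_norml lerNl opprB H// andbT.
by rewrite distrC H.
Qed.

Lemma dist_le_ln (R : realType) (M x y : R) :
  0 < x <= M -> 0 < y <= M -> `|x - y| <= M * `|ln x - ln y|.
Proof.
have H (a b : R) : 0 < a <= M -> 0 < b -> a - b <= M * `|ln a - ln b|.
  move=> /andP[a0 aM] b0; apply: le_trans (_ : a * (ln a - ln b) <= _).
    have : b / a = expR (ln b - ln a) by rewrite -ln_div ?posrE// lnK ?posrE ?divr_gt0.
    have := expR_ge1Dx (ln b - ln a) => h /esym e; move: h; rewrite e.
    by rewrite ler_pdivlMr// => ?; nra.
  apply: le_trans (ler_wpM2l (ltW a0) (ler_norm _)) _.
  by rewrite ler_wpM2r.
move=> xM yM; rewrite ler_norml lerNl opprB H//; last by case/andP: yM.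
by rewrite distrC H//; case/andP: xM.
Qed.

Lemma const_int (T : Type) (F : int -> T) :
  (forall n : int, F n = F (n - 1)) -> forall n : int, F n = F 0.
Proof.
move=> hF; elim/int_rect=> [//|n IH|n IH].
  by rewrite hF (_ : _ - 1 = n%:Z); [exact: IH | lia].
by rewrite -IH (hF (- n%:Z)); congr F; lia.
Qed.

Lemma dist_same_sign (R : realType) (x y : R) :
  0 < x * y -> `|x - y| = `| `|x| - `|y| |.
Proof.
have [x0|x0|->] := ltrgt0P x; last by rewrite mul0r ltxx.
  by rewrite pmulr_rgt0// => y0; rewrite (gtr0_norm y0).
rewrite nmulr_rgt0// => y0; rewrite (ltr0_norm y0).
by rewrite -normrN opprB opprK addrC.
Qed.

(** Fine common almost periods of numerator and denominator of the coefficient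
    are almost periods of the solution up to sign.  The logarithm of the absolute value is handled by
    bounded_sum_translation, while the sign of v (n + p) v n does not depend
    on n, as a fine translation changes no sign among the x n and the y n. *)
Lemma solution_translation (R : realType) (x y v : int -> R) (c m M : R) :
  0 < c -> (forall n, c <= `|x n|) -> (forall n, c <= `|y n|) ->
  0 < m -> (forall n, m <= `|v n|) -> (forall n, `|v n| <= M) ->
  (forall n : int, v n = y n / x n * v (n - 1)) ->
  (forall d : R, 0 < d ->
     relatively_dense (translation_set x d `&` translation_set y d)) ->
  forall eps : R, 0 < eps -> exists2 d : R, 0 < d &
    forall p : int, translation_set x d p -> translation_set y d p ->
      exists2 s : R, s = 1 \/ s = -1 & forall n, `|v (n + p) - s * v n| < eps.
Proof.
move=> c0 cx cy m0 mv vM hv hap eps eps0.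
have M0 : 0 < M by apply: lt_le_trans (vM 0); apply: lt_le_trans (mv 0).
have x0 n : x n != 0 by rewrite -normr_gt0; apply: lt_le_trans (cx n).
have y0 n : y n != 0 by rewrite -normr_gt0; apply: lt_le_trans (cy n).
have v0 n : v n != 0 by rewrite -normr_gt0; apply: lt_le_trans (mv n).
pose B n := ln `|v n|.
have BE n : B n - B (n - 1) = ln `|y n| - ln `|x n|.
  have pos (z : R) : z != 0 -> `|z| \is Num.pos by rewrite posrE normr_gt0.
  have -> : B n = ln (`|y n| / `|x n| * `|v (n - 1)|).
    by rewrite /B {1}hv !normrM normfV.
  rewrite lnM ?posrE ?mulr_gt0 ?invr_gt0 ?normr_gt0//.
  by rewrite ln_div ?pos// addrK.
have Btrans d p : translation_set x (d * c / 2) p ->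
    translation_set y (d * c / 2) p ->
    translation_set (fun n => B n - B (n - 1)) d p.
  move=> hx hy n /=; rewrite !BE.
  have bound (z : int -> R) : (forall n, c <= `|z n|) -> translation_set z (d * c / 2) p ->
      `|ln `|z (n + p)| - ln `|z n| | < d / 2.
    move=> cz hz; apply: le_lt_trans (ln_dist_le c0 (cz _) (cz _)) _.
    rewrite ltr_pdivrMr// mulrAC; apply: le_lt_trans (hz n).
    exact: ler_dist_dist.
  have := bound x cx hx; have := bound y cy hy; move=> ? ?; norm_lra.
have Bb n : `|B n| <= `|ln m| + `|ln M|.
  have h1 : ln m <= B n by rewrite ler_ln ?posrE ?normr_gt0.
  have h2 : B n <= ln M by rewrite ler_ln ?posrE ?normr_gt0.
  have := ler_norm (ln M); have := ler_norm (- ln m); rewrite normrN.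
  have := normr_ge0 (ln m); have := normr_ge0 (ln M) => *; norm_lra.
have Bap : ap_int (fun n => B n - B (n - 1)).
  move=> d d0; have /hap/relatively_dense_intP[l l0 hl] : 0 < d * c / 2.
    by rewrite divr_gt0 ?mulr_gt0.
  apply/relatively_dense_intP; exists l => // a; have [p ap [hx hy]] := hl a.
  by exists p => //; exact: Btrans.
have [d d0 hd] := bounded_sum_translation Bb Bap (divr_gt0 eps0 M0).
exists (Num.min (d * c / 2) c) => [|p hx hy].
  by rewrite lt_min c0 divr_gt0 ?mulr_gt0.
have [hx1 hx2] : translation_set x (d * c / 2) p /\ translation_set x c p.
  by split=> n; have := hx n; rewrite lt_min => /andP[].
have [hy1 hy2] : translation_set y (d * c / 2) p /\ translation_set y c p.
  by split=> n; have := hy n; rewrite lt_min => /andP[].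
have vdist n : `| `|v (n + p)| - `|v n| | < eps.
  have h : `|B (n + p) - B n| < eps / M := hd p (Btrans _ _ hx1 hy1) n.
  apply: le_lt_trans (dist_le_ln (M := M) _ _) _; rewrite ?normr_gt0 ?v0 ?vM//.
  by rewrite mulrC -ltr_pdivlMr.
have same (z : int -> R) : (forall n, c <= `|z n|) -> translation_set z c p ->
    forall n, 0 < z (n + p) * z n.
  move=> cz hz n; have := hz n; have := cz n; have := cz (n + p).
  rewrite !lter_normr => /orP[?|?] /orP[?|?] ?; norm_hyps; nra.
pose w n := v (n + p) * v n.
have sgw n : (0 < w n) = (0 < w (n - 1)).
  have -> : w n = (y (n + p) * y n) / (x (n + p) * x n) * w (n - 1).
    by rewrite /w !(hv n, hv (n + p)) addrAC invfM mulrACA (mulrACA (y _)).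
  by rewrite pmulr_rgt0// divr_gt0// same.
have w0 n : w n != 0 by rewrite mulf_neq0.
have wconst := const_int sgw.
have [w00|w00] := boolP (0 < w 0).
  exists 1 => [|n]; first by left.
  by rewrite mul1r dist_same_sign// -/(w n) wconst.
exists (-1) => [|n]; first by right.
rewrite mulN1r dist_same_sign ?normrN// mulrN oppr_gt0 -/(w n).
by rewrite lt_neqAle w0 leNgt wconst.
Qed.

(** * The continuous factor *)

Lemma uc_continuous (R : realType) (f : R -> R) :
  (forall eps : R, 0 < eps -> exists2 delta : R, 0 < delta &
     forall s t : R, `|s - t| < delta -> `|f s - f t| < eps) ->
  continuous f.
Proof.
move=> uc x; apply/cvgrPdist_lt => eps eps0.
have [d d0 hd] := uc eps eps0.
by exists d => // y /= /hd.
Qed.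

(** The jump condition on v is what makes the quotient h / v continuous across
    the points of tau. *)
Lemma quotient_uc (R : realType) (tau : int -> R) (h f : R -> R)
    (v : int -> R) (theta m : R) :
  0 < theta -> (forall j : int, theta <= tau (j + 1) - tau j) ->
  admissible tau ->
  piecewise_uc tau h -> (forall j : int, cvg (h x @[x --> (tau j)^'+])) ->
  0 < m -> (forall n, m <= `|v n|) ->
  (forall n : int, right_lim h (tau n) / v n = h (tau n) / v (n - 1)) ->
  (forall (n : int) (t : R), tau n < t <= tau (n + 1) -> f t = h t / v n) ->
  forall eps : R, 0 < eps -> exists2 delta : R, 0 < delta &
    forall s t : R, `|s - t| < delta -> `|f s - f t| < eps.
Proof.
move=> theta0 sep adm uc hcv m0 mv jump hf eps eps0.
have [d d0 hd] := uc (eps / 3 * m) (mulr_gt0 (divr_gt0 eps0 (ltr0n _ 3)) m0).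
have inc j : tau j < tau (j + 1) by have := sep j; lra.
have rl := right_lim_close inc hcv hd.
have quot n (a b : R) : `|a - b| <= eps / 3 * m -> `|a / v n - b / v n| <= eps / 3.
  move=> ab; rewrite -mulrBl normrM normfV ler_pdivrMr.
    by apply: le_trans ab _; rewrite ler_wpM2l// divr_ge0// ltW.
  exact: lt_le_trans (mv n).
exists (Num.min d theta); first by rewrite lt_min d0.
have main s t : s <= t -> t - s < Num.min d theta -> `|f s - f t| < eps.
  move=> st; rewrite lt_min => /andP[td tth].
  have [n /andP[n1 n2]] := admissible_interval adm s.
  have fs : f s = h s / v n by apply: hf; rewrite n1.
  have [tn|tn] := leP t (tau (n + 1)).
    rewrite fs (hf n t) ?tn ?andbT ?(lt_le_trans n1 st)//.
    have /(quot n) : `|h s - h t| <= eps / 3 * m.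
      by apply/ltW/(hd n); [rewrite n1|rewrite tn (lt_le_trans n1 st)|norm_lra].
    by move=> ?; norm_lra.
  have sepn := sep (n + 1).
  have tn2 : t <= tau (n + 1 + 1) by lra.
  have /(quot n) q1 : `|h s - h (tau (n + 1))| <= eps / 3 * m.
    by apply/ltW/(hd n); [rewrite n1|rewrite inc lexx|norm_lra].
  have /(quot (n + 1)) q2 : `|h t - right_lim h (tau (n + 1))| <= eps / 3 * m.
    by apply: rl; [rewrite tn|lra].
  move: q2; rewrite jump addrK => q2.
  by rewrite fs (hf (n + 1) t) ?tn//; norm_lra.
move=> s t; have [st|/ltW ts] := leP s t; rewrite ltr_norml => /andP[? ?].
  by apply: main => //; lra.
by rewrite distrC; apply: main => //; lra.
Qed.

Lemma piecewise_uc_bounded (R : realType) (tau : int -> R) (h : R -> R)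
    (D H0 : R) :
  admissible tau -> (forall j : int, tau (j + 1) - tau j <= D) ->
  piecewise_uc tau h -> (forall j, `|h (tau j)| <= H0) ->
  exists2 H : R, 0 < H & forall t, `|h t| <= H.
Proof.
move=> adm hD uc hH0; have [inc _ _] := adm.
have H00 : 0 <= H0 by apply: le_trans (hH0 0).
have [d d0 hd] := uc 1 ltr01.
(* The interval is covered from the right end by steps of length d / 2. *)
have chain (k : nat) (j : int) (t : R) : tau j < t <= tau (j + 1) ->
    tau (j + 1) - t <= k%:R * (d / 2) -> `|h t| <= H0 + k%:R.
  elim: k t => [|k IH] t /andP[t1 t2].
    rewrite mul0r addr0 => tt; have -> : t = tau (j + 1) by lra.
    exact: hH0.
  rewrite -natr1 mulrDl mul1r => tk.
  have [le|lt] := leP (t + d / 2) (tau (j + 1)).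
    have : `|h (t + d / 2)| <= H0 + k%:R.
      by apply: IH; [apply/andP; split; lra | lra].
    have : `|h t - h (t + d / 2)| < 1.
      by apply: (hd j); [rewrite t1|apply/andP; split; lra|norm_lra].
    by move=> ? ?; norm_lra.
  have : `|h t - h (tau (j + 1))| < 1.
    by apply: (hd j); [rewrite t1|rewrite inc lexx|norm_lra].
  have := hH0 (j + 1); have := ler0n R k; move=> ? ? ?; norm_lra.
pose N := (Num.truncn (D / (d / 2))).+1.
exists (H0 + N%:R) => [|t]; first by rewrite ltr_wpDl ?ltr0n.
have [n ntn] := admissible_interval adm t.
apply: chain (ntn) _; case/andP: ntn => ? ?.
apply: le_trans (_ : D <= _); first by have := hD n; lra.
by rewrite -ler_pdivrMr ?divr_gt0// ltW// truncnS_gt.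
Qed.

(** * Almost periodicity of the factors *)

Lemma twice_translation (R : realType) (G : numDomainType) (F : G -> R)
    (eps s : R) (p : G) :
  s = 1 \/ s = -1 -> (forall t, `|F (t + p) - s * F t| < eps / 2) ->
  translation_set F eps (p + p).
Proof.
move=> hs hF t; have := hF t; have := hF (t + p); rewrite -addrA.
by case: hs => ->; rewrite ?mul1r ?mulN1r => ? ?; norm_lra.
Qed.

Lemma relatively_dense_int_double (S T : set int) :
  relatively_dense S -> (forall p, S p -> T (p + p)) -> relatively_dense T.
Proof.
move=> /relatively_dense_intP[l l0 hl] ST.
apply/relatively_dense_intP; exists (l + l + 2) => [|a]; first by lia.
have [b hb] : exists b : int, a <= b + b <= a + 1.
  have [k hk] : exists k : nat, (absz a = k + k \/ absz a = k + k + 1)%N.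
    by exists (absz a)./2; lia.
  have [?|?] := lerP 0 a; last by exists (- k%:Z); lia.
  by case: hk => ?; [exists k%:Z; lia | exists (k%:Z + 1); lia].
by have [p bp hp] := hl b; exists (p + p); [lia | exact: ST].
Qed.

Lemma joint_period_dense_int (R : realType) (tau : int -> R) (h : R -> R)
    (theta eps L : R) :
  0 < theta -> (forall j : int, theta <= tau (j + 1) - tau j) -> 0 < eps ->
  (forall a : R, exists r p, a <= r <= a + L /\ joint_period tau h eps r p) ->
  relatively_dense [set p : int | exists r, joint_period tau h eps r p].
Proof.
move=> theta0 sep eps0 hL; apply/relatively_dense_intP.
have [l l0 hl] := int_floor ((2 * eps + L) / theta).
exists l => // a.
have [r [p [/andP[r1 r2] hrp]]] := hL (tau a - tau 0 + eps).
exists p; last by exists r.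
have [/(_ 0)] := hrp; rewrite add0r => near _.
have ap : a < p by apply: (separated_lt_idx theta0 sep); norm_hyps; lra.
rewrite (ltW ap) /= -lerBlDl -(ler_int R); apply: le_trans hl.
rewrite ler_pdivlMr//; apply: le_trans (incr_ge sep (ltW ap)) _.
by norm_hyps; lra.
Qed.

(** A fine enough joint period is an almost period of both factors, up to a
    common sign. *)
Lemma joint_period_factors (R : realType) (tau : int -> R) (h f : R -> R)
    (v : int -> R) (theta m H : R) :
  0 < theta -> (forall j : int, theta <= tau (j + 1) - tau j) ->
  admissible tau -> 0 < m -> (forall n, m <= `|v n|) ->
  0 < H -> (forall t, `|h t| <= H) ->
  (forall (n : int) (t : R), tau n < t <= tau (n + 1) -> f t = h t / v n) ->
  (forall eps : R, 0 < eps -> exists2 delta : R, 0 < delta &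
    forall s t : R, `|s - t| < delta -> `|f s - f t| < eps) ->
  (forall eps : R, 0 < eps -> exists2 e : R, 0 < e &
    forall r p, joint_period tau h e r p ->
      exists2 s : R, s = 1 \/ s = -1 & forall n, `|v (n + p) - s * v n| < eps) ->
  forall eps : R, 0 < eps -> exists2 e : R, 0 < e &
    forall r p, joint_period tau h e r p ->
      exists2 s : R, s = 1 \/ s = -1 &
        (forall n, `|v (n + p) - s * v n| < eps) /\
        (forall t, `|f (t + r) - s * f t| < eps).
Proof.
move=> theta0 sep adm m0 mv H0 hH hf fuc vap eps eps0.
have eps40 : 0 < eps / 4 by rewrite divr_gt0.
have [d d0 hd] := fuc _ eps40.
have eps10 : 0 < eps / 4 * m * m / H by rewrite divr_gt0 ?mulr_gt0.
(* The threshold for v comes from |1 / v (n + p) - s / v n| < eps1 / m ^ 2 and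
   the bound H on h. *)
pose eps1 := Num.min eps (eps / 4 * m * m / H).
have [e1 e10 he1] : exists2 e : R, 0 < e & forall r p, joint_period tau h e r p ->
    exists2 s : R, s = 1 \/ s = -1 & forall n, `|v (n + p) - s * v n| < eps1.
  by apply: vap; rewrite lt_min eps0.
have [e2 e20 [e21 e22 e23]] : exists2 e : R, 0 < e &
    [/\ e <= theta / 6, e <= d / 4 & e <= eps / 4 * m].
  by apply: small_pos; rewrite ?mulr_gt0 ?divr_gt0.
pose e := Num.min e1 e2.
have e0 : 0 < e by rewrite lt_min e10.
have [ee1 ee2] : e <= e1 /\ e <= e2 by rewrite !ge_min !lexx orbT.
exists e => // r p joint.
have [s hs vs] := he1 r p (joint_period_le ee1 joint).
exists s => //; split=> [n|t].
  by apply: lt_le_trans (vs n) _; rewrite ge_min lexx.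
have [near hr] := joint.
(* By uniform continuity of f, it suffices to treat points y away from tau. *)
have [y /andP[y1 y2] fary] : exists2 y, t <= y <= t + 3 * e &
    forall j, e < `|y - tau j|.
  by apply: (shift_away (separated_le theta0 sep)) => //; lra.
have [n nyn] := admissible_interval adm y; have /andP[n1 n2] := nyn.
have m1 : e < y - tau n by have := fary n; rewrite gtr0_norm ?subr_gt0.
have m2 : e < tau (n + 1) - y.
  by have := fary (n + 1); rewrite distrC ger0_norm ?subr_ge0.
have fy := hf n y nyn.
have fyr : f (y + r) = h (y + r) / v (n + p).
  apply: hf; have := near n; have := near (n + 1).
  by rewrite (addrAC n 1) => ? ?; norm_hyps; apply/andP; split; lra.
have v0 k : v k != 0 by rewrite -normr_gt0; apply: lt_le_trans (mv k).
have vp k : 0 < `|v k| by rewrite normr_gt0.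
have b1 : `|(h (y + r) - h y) / v (n + p)| < eps / 4.
  rewrite normrM normfV ltr_pdivrMr//; apply: lt_le_trans (hr y fary) _.
  apply: le_trans ee2 (le_trans e23 _).
  by rewrite ler_wpM2l// ltW.
have ss : s * s = 1 by case: hs => ->; rewrite ?mulrNN mul1r.
have ns : `|s| = 1 by case: hs => ->; rewrite ?normrN normr1.
have b2 : `|h y * (v n - s * v (n + p)) / (v (n + p) * v n)| <= eps / 4.
  rewrite !normrM normfV normrM ler_pdivrMr ?mulr_gt0//.
  have -> : v n - s * v (n + p) = - (s * (v (n + p) - s * v n)).
    by rewrite mulrBr mulrA ss mul1r opprB.
  rewrite normrN normrM ns mul1r.
  apply: le_trans (_ : H * (eps / 4 * m * m / H) <= _).
    apply: ler_pM => //; apply/ltW/(lt_le_trans (vs n)).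
    by rewrite ge_min lexx orbT.
  rewrite mulrC divfK ?lt0r_neq0// -mulrA ler_wpM2l ?(ltW eps40)//.
  by apply: ler_pM => //; exact: ltW.
have key : f (y + r) - s * f y =
    (h (y + r) - h y) / v (n + p) + h y * (v n - s * v (n + p)) / (v (n + p) * v n).
  by rewrite fy fyr; field; rewrite !v0.
have c1 : `|f (t + r) - f (y + r)| < eps / 4 by apply: hd; norm_lra.
have c2 : `|s * (f t - f y)| < eps / 4.
  by rewrite normrM ns mul1r; apply: hd; norm_lra.
move: c2; rewrite mulrBr => c2; move: b1 b2 c1 c2 key; clear => *.
by norm_lra.
Qed.

(** * Uniqueness and the factorization theorem *)

Lemma factorization_right_lim (R : realType) (tau : int -> R) (h f : R -> R)
    (u : int -> R) :
  (forall j : int, tau j < tau (j + 1)) -> continuous f ->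
  pc_factorization tau h f u ->
  forall n, right_lim h (tau n) = f (tau n) * u n.
Proof.
move=> inc cf fact n; apply/cvg_lim => //.
have : f x * u n @[x --> (tau n)^'+] --> f (tau n) * u n.
  by apply: cvgMl; apply: cvg_at_right_filter; exact: cf.
apply: cvg_trans; apply: near_eq_cvg.
have := nbhs_right_lt (inc n); have := nbhs_right_gt (tau n).
by move=> gt lt; near=> x; symmetry; apply: fact; apply/andP; split;
  [near: x | apply: ltW; near: x].
Unshelve. all: by end_near. Qed.

(** Left and right limits of the two factorizations at tau n show that the
    quotient of the discrete factors does not change from n - 1 to n. *)
Lemma factorization_unique (R : realType) (tau : int -> R) (h f f' : R -> R)
    (u u' : int -> R) :
  admissible tau -> continuous f -> continuous f' ->
  (forall n, h (tau n) != 0) -> (forall n, right_lim h (tau n) != 0) ->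
  pc_factorization tau h f u -> pc_factorization tau h f' u' ->
  exists2 c : R, c != 0 &
    (forall n : int, u' n = c * u n) /\ (forall t : R, f' t = c^-1 * f t).
Proof.
move=> adm cf cf' hl0 hr0 fact fact'; have [inc _ _] := adm.
have left g w n : pc_factorization tau h g w -> h (tau n) = g (tau n) * w (n - 1).
  by apply; rewrite subrK lexx andbT; have := inc (n - 1); rewrite subrK.
have R1 := factorization_right_lim inc cf fact.
have R2 := factorization_right_lim inc cf' fact'.
have L1 n := left _ _ n fact; have L2 n := left _ _ n fact'.
have nz n : [/\ f (tau n) != 0, f' (tau n) != 0, u n != 0 & u' n != 0].
  have := hr0 n; rewrite R1 mulf_eq0 negb_or => /andP[-> ->].
  by have := hr0 n; rewrite R2 mulf_eq0 negb_or => /andP[-> ->].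
have q n : u' n / u n = u' (n - 1) / u (n - 1).
  have [f0 f0' u0 _] := nz n; have [_ _ u1 _] := nz (n - 1).
  have e1 : f (tau n) * u n = f' (tau n) * u' n by rewrite -R1 R2.
  have e2 : f (tau n) * u (n - 1) = f' (tau n) * u' (n - 1) by rewrite -L1 L2.
  apply: (mulfI f0'); rewrite !mulrA -e1 -e2 !mulfK//.
have qc := const_int q.
have [_ _ u0 u0'] := nz 0.
have c0 : u' 0 / u 0 != 0 by rewrite mulf_neq0 ?invr_eq0.
have uc n : u' n = u' 0 / u 0 * u n.
  by have [_ _ un _] := nz n; rewrite -(qc n) divfK.
exists (u' 0 / u 0) => //; split => // t.
have [n nt] := admissible_interval adm t.
have [_ _ un un'] := nz n.
have := fact' n t nt; rewrite (fact n t nt) (uc n) => e.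
apply: (mulfI c0); rewrite mulVKf//; apply: (mulIf un).
by rewrite e mulrCA mulrA.
Qed.

Theorem theorem1p1 (R : realType) (tau : int -> R) (h : R -> R)
    (htau : wexler tau) (hh : pcap_on tau h)
    (hl : 0 < inf (range (fun n : int => `|h (tau n)|)))
    (hr : 0 < inf (range (fun n : int => `|right_lim h (tau n)|)))
    (hv : exists v : int -> R,
        [/\ forall n : int,
              v n = right_lim h (tau n) / h (tau n) * v (n - 1),
            [bounded v n | n in setT]
          & 0 < inf (range (fun n : int => `|v n|))]) :
  exists (f : R -> R) (u : int -> R),
    [/\ ap_real f, ap_int u, pc_factorization tau h f u
      & forall (f' : R -> R) (u' : int -> R),
          ap_real f' -> ap_int u' -> pc_factorization tau h f' u' ->
          exists2 c : R, c != 0 &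
            (forall n : int, u' n = c * u n) /\
            (forall t : R, f' t = c^-1 * f t)].
Proof.
have [adm gap0 eap] := htau.
have [[_ _ _ hcv] _ ii iii] := hh.
have [v [hv1 vbd vinf]] := hv.
have [inc _ _] := adm.
pose theta := inf (range (tdiff tau 1)).
have sep j : theta <= tau (j + 1) - tau j.
  by apply: (inf_range_le (F := tdiff tau 1)) => i; rewrite subr_ge0 ltW.
have uc : piecewise_uc tau h.
  by move=> eps /ii[d d0 hd]; exists d.
have lbl := inf_range_le (F := fun n => `|h (tau n)|) (fun n => normr_ge0 _).
have lbr := inf_range_le (F := fun n => `|right_lim h (tau n)|)
  (fun n => normr_ge0 _).
have mv := inf_range_le (F := fun n => `|v n|) (fun n => normr_ge0 _).
have [M vM] : exists M, forall n, `|v n| <= M.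
  have [M [_ hM]] := vbd; exists (M + 1) => n.
  by apply: (hM (M + 1)) => //; rewrite ltrDl.
have hl0 n : h (tau n) != 0 by rewrite -normr_gt0 (lt_le_trans hl)// lbl.
have hr0 n : right_lim h (tau n) != 0 by rewrite -normr_gt0 (lt_le_trans hr)// lbr.
have v0 n : v n != 0 by rewrite -normr_gt0 (lt_le_trans vinf)// mv.
have jdense := joint_period_dense gap0 sep adm eap uc iii.
have jvalues := joint_period_values gap0 sep uc hcv.
have jint e : 0 < e ->
    relatively_dense [set p : int | exists r, joint_period tau h e r p].
  move=> e0; have [L L0 hL] := jdense e e0.
  exact: joint_period_dense_int gap0 sep e0 hL.
have coef_ap e : 0 < e -> relatively_dense
    (translation_set (h \o tau) e `&` translation_set (right_lim h \o tau) e).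
  move=> e0; have [d d0 hd] := jvalues e e0.
  have /relatively_dense_intP[l l0 hll] := jint d d0.
  apply/relatively_dense_intP; exists l => // a.
  have [p ap [r hrp]] := hll a; exists p => //.
  by split=> n; have [] := hd r p hrp n.
have vjoint eps : 0 < eps -> exists2 e : R, 0 < e &
    forall r p, joint_period tau h e r p ->
      exists2 s : R, s = 1 \/ s = -1 & forall n, `|v (n + p) - s * v n| < eps.
  move=> eps0; pose c := Num.min (inf (range (fun n => `|h (tau n)|)))
    (inf (range (fun n => `|right_lim h (tau n)|))).
  have c0 : 0 < c by rewrite lt_min hl.
  have [d d0 hd] : exists2 d : R, 0 < d & forall p : int,
      translation_set (h \o tau) d p -> translation_set (right_lim h \o tau) d p ->
      exists2 s : R, s = 1 \/ s = -1 & forall n, `|v (n + p) - s * v n| < eps.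
    apply: (solution_translation c0 _ _ vinf mv vM hv1 coef_ap) => //= n.
      by rewrite ge_min lbl.
    by rewrite ge_min lbr orbT.
  have [e e0 he] := jvalues d d0; exists e => // r p hrp.
  by apply: hd => n; have [] := he r p hrp n.
have [idx hidx] : {idx : R -> int & forall t, tau (idx t) < t <= tau (idx t + 1)}.
  exact: choice (admissible_interval adm).
pose f t := h t / v (idx t).
have hf n t : tau n < t <= tau (n + 1) -> f t = h t / v n.
  by move=> nt; rewrite /f (interval_idx_unique gap0 sep (hidx t) nt).
have jump n : right_lim h (tau n) / v n = h (tau n) / v (n - 1).
  by have := hv1 n; have := v0 n => + e; rewrite e => vn; field;
    rewrite hl0 hr0 v0.
have fuc := quotient_uc gap0 sep adm uc hcv vinf mv jump hf.
have fact : pc_factorization tau h f v.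
  by move=> n t nt; rewrite (hf n t nt) divfK.
have fcont := uc_continuous fuc.
have [D D0 hD] := equipotentially_ap_gap_bounded eap.
have [H0 _ hH0] : exists2 H0 : R, 0 < H0 & forall n, `|(h \o tau) n| <= H0.
  apply: ap_int_bounded => e /coef_ap/relatively_dense_intP[l l0 hll].
  apply/relatively_dense_intP; exists l => // a.
  by have [p ap []] := hll a; exists p.
have [H Hp hH] := piecewise_uc_bounded adm hD uc hH0.
have joint := joint_period_factors gap0 sep adm vinf mv Hp hH hf fuc vjoint.
exists f, v; split=> //.
- split=> // eps eps0; have [e e0 he] := joint _ (divr_gt0 eps0 (ltr0n _ 2)).
  have [L L0 hL] := jdense e e0.
  apply/relatively_denseP; exists (2 * L) => [|a]; first by rewrite mulr_gt0.
  have [r [p [/andP[ar rL] /he[s hs [_ fs]]]]] := hL (a / 2).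
  exists (r + r); first by apply/andP; split; lra.
  exact: twice_translation hs fs.
- move=> eps eps0; have [e e0 he] := joint _ (divr_gt0 eps0 (ltr0n _ 2)).
  apply: relatively_dense_int_double (jint e e0) _ => p [r /he[s hs [vs _]]].
  exact: twice_translation hs vs.
- move=> f' u' [cf' _] _ fact'.
  exact: factorization_unique adm fcont cf' hl0 hr0 fact fact'.
Qed.
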